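(* Let $p\geq 3$ be a prime and $q=p^r$, $r\geq 1$. Fix $f\in\mathbb{F}_q^\times$, and for $t\in\mathbb{F}_q^\times$ consider the curve $E_{t,f}: y^2=x^3+fx^2+\frac{x}{t}$ over $\mathbb{F}_q$. Then $$\sum_{t\in\mathbb{F}_q^\times}\varphi(t(t-1))\,a_q(E_{t,f})=\begin{cases}-\varphi(f)-q\cdot\varphi(2f), & \text{if } f^2=4;\\ -\varphi(f), & \text{if } f^2-4 \text{ is not a square in }\mathbb{F}_q;\\ -\varphi(f)-q\cdot\varphi(2f)\left(\varphi\left(1+\frac af\right)+\varphi\left(1-\frac af\right)\right), & \text{if } f^2-4=a^2 \text{ with } a\in\mathbb{F}_q^\times.\end{cases}$$
   Context: $\varphi$ is the quadratic character on $\mathbb{F}_q$ (with $\varphi(0)=0$). For a curve $E$ in Weierstrass form over $\mathbb{F}_q$, $a_q(E):=q+1-\#E(\mathbb{F}_q)$, where $\#E(\mathbb{F}_q)$ is the number of $\mathbb{F}_q$-points on $E$ including the point at infinity (i.e. $1$ plus the number of $(x,y)\in\mathbb{F}_q^2$ satisfying the equation); this formula is used for every $t\in\mathbb{F}_q^\times$. *)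

(* Defs.v *)
From HB Require Import structures.
From mathcomp Require Import all_boot all_order all_algebra all_field.

Set Implicit Arguments.
Unset Strict Implicit.
Unset Printing Implicit Defensive.

Import GRing.Theory Num.Theory.
Local Open Scope ring_scope.

Definition quad_char (F : finFieldType) (x : F) : int :=
  if x == 0 then 0 else if [exists y : F, x == y ^+ 2] then 1 else -1.

(* Coefficients of y^2 + a1 x y + a3 y = x^3 + a2 x^2 + a4 x + a6.
   Nonsingularity is deliberately not required: the point count below is also
   used for singular members of a family. *)
Record weierstrass (F : Type) := Weierstrass {
  wa1 : F; wa2 : F; wa3 : F; wa4 : F; wa6 : F }.

Definition affine_points (F : finFieldType) (E : weierstrass F) :
    {set F * F} :=
  [set P : F * F |
    P.2 ^+ 2 + wa1 E * P.1 * P.2 + wa3 E * P.2 ==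
    P.1 ^+ 3 + wa2 E * P.1 ^+ 2 + wa4 E * P.1 + wa6 E].

(* The summand 1 is the point at infinity. *)
Definition num_points (F : finFieldType) (E : weierstrass F) : nat :=
  (1 + #|affine_points E|)%N.

Definition frob_trace (F : finFieldType) (E : weierstrass F) : int :=
  #|F|%:Z + 1 - (num_points E)%:Z.

(* y^2 = x^3 + f x^2 + x / t *)
Definition Etf (F : finFieldType) (t f : F) : weierstrass F :=
  {| wa1 := 0; wa2 := f; wa3 := 0; wa4 := t^-1; wa6 := 0 |}.

(* Main.v *)
Require Import Defs.
From HB Require Import structures.
From mathcomp Require Import all_boot all_order all_algebra all_field.
From mathcomp Require Import fingroup cyclic ring.

Set Implicit Arguments.
Unset Strict Implicit.
Unset Printing Implicit Defensive.

Import GRing.Theory Num.Theory.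
Local Open Scope ring_scope.

(** Write phi for [quad_char] and q for the order of F, which is odd.

    Counting the points of y^2 = g(x) fibre by fibre gives the trace as minus
    the sum over x of phi (g x), since 1 + phi c is the number of square roots
    of c ([frob_trace_Etf]).  Multiplying by phi t clears the denominator of
    the family: t (x^3 + f x^2 + x / t) = x (t A + 1) with A = x^2 + f x.
    After exchanging the two sums,

      S = - sum over x of phi x * (sum over t of phi ((t - 1) (t A + 1))).

    The point t = 0, missing from the original sum, may be added because it
    contributes phi (-1) times the sum of phi over F, which vanishes.

    The inner sum runs over a quadratic in t with the obvious root t = 1.
    Dividing by (t - 1)^2, a square, turns phi of it into phi of the affine
    function A + (A + 1) u of u = 1 / (t - 1), which takes all nonzero values;
    so the sum is - phi A, except when A = -1, where the quadratic is
    - (t - 1)^2 and q phi (-1) has to be added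
    ([sum_quad_char_quadratic]).

    Hence S = (sum over x of phi x * phi (x (x + f)))
              - q * (sum of phi (- x) over the roots of x^2 + f x + 1).
    In the first sum phi x * phi (x (x + f)) = phi (x + f) for x nonzero, so
    it is - phi f.  The discriminant of x^2 + f x + 1 is f^2 - 4, and the three
    cases of the theorem say whether there are one, zero or two roots; phi of
    the opposite of a root (- f + s) / 2, with s^2 = f^2 - 4, is
    phi (2 f) phi (1 - s / f) because 4 is a square. *)

(** * The quadratic character *)

Section QuadraticCharacter.

Variable F : finFieldType.
Implicit Types x y a b c f s t A : F.

Lemma quad_char0 : quad_char (0 : F) = 0.
Proof. by rewrite /quad_char eqxx. Qed.

Lemma quad_char_sqr y : y != 0 -> quad_char (y ^+ 2) = 1.
Proof.
move=> y0; rewrite /quad_char expf_eq0 /= (negbTE y0).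
by case: existsP => // -[]; exists y.
Qed.

Lemma quad_char1 : quad_char (1 : F) = 1.
Proof. by rewrite -(expr1n _ 2) quad_char_sqr ?oner_neq0. Qed.

Lemma quad_char_nonsquare x : ~ (exists y, x = y ^+ 2) -> quad_char x = -1.
Proof.
move=> xNsq; rewrite /quad_char; case: eqP => [x0|_].
  by case: xNsq; exists 0; rewrite x0 expr0n.
by case: existsP => // -[y /eqP xy]; case: xNsq; exists y.
Qed.

Lemma square_or_nonsquare x :
  (exists y, x = y ^+ 2) \/ ~ (exists y, x = y ^+ 2).
Proof.
by case: (@existsP F (fun y => x == y ^+ 2)) => [[y /eqP e]|n]; [left; exists y
  | right=> -[y e]; apply: n; exists y; rewrite e].
Qed.

(** The multiplicative group is cyclic, and the nonsquares are odd powers of a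
    generator; two odd exponents have an even sum. *)
Lemma nonsquareM x y :
    ~ (exists z, x = z ^+ 2) -> ~ (exists z, y = z ^+ 2) ->
  exists z, x * y = z ^+ 2.
Proof.
have /cyclicP[g gen] := field_unit_group_cyclic [set: {unit F}].
have powg z : z != 0 -> exists k, z = val g ^+ k.
  move=> z0; have : finField_unit z0 \in <[g]>%g by rewrite -gen inE.
  case/cycleP=> k e; exists k.
  by rewrite -[LHS]/(val (finField_unit z0)) e FinRing.val_unitX.
have oddpow z : ~ (exists w, z = w ^+ 2) -> exists2 k, odd k & z = val g ^+ k.
  move=> zN; have [z0|/powg[k zk]] := eqVneq z 0.
    by case: zN; exists 0; rewrite z0 expr0n.
  exists k => //; apply/negPn/negP => kev; apply: zN.
  by exists (val g ^+ k./2); rewrite -exprM muln2 halfK (negbTE kev) subn0.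
move=> /oddpow[k ko ->] /oddpow[l lo ->]; exists (val g ^+ (k + l)./2).
by rewrite -exprM muln2 halfK oddD ko lo /= subn0 exprD.
Qed.

Lemma quad_charM x y : quad_char (x * y) = quad_char x * quad_char y.
Proof.
have sqM a b : a != 0 -> quad_char (a ^+ 2 * b) = quad_char b.
  move=> a0; have [-> |b0] := eqVneq b 0; first by rewrite mulr0.
  have [[c bc]|bN] := square_or_nonsquare b.
    by rewrite bc -exprMn !quad_char_sqr ?mulf_neq0 //;
       move: b0; rewrite bc expf_eq0.
  rewrite !quad_char_nonsquare // => -[z e]; apply: bN; exists (z / a).
  by rewrite expr_div_n -e mulrC mulKf // expf_neq0.
have [-> |x0] := eqVneq x 0; first by rewrite mul0r quad_char0 mul0r.
have [-> |y0] := eqVneq y 0; first by rewrite mulr0 quad_char0 mulr0.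
have [[a xa]|xN] := square_or_nonsquare x.
  have a0 : a != 0 by move: x0; rewrite xa expf_eq0.
  by rewrite xa sqM // quad_char_sqr ?mul1r.
have [[a ya]|yN] := square_or_nonsquare y.
  have a0 : a != 0 by move: y0; rewrite ya expf_eq0.
  by rewrite ya mulrC sqM // quad_char_sqr ?mulr1.
have [z xyz] := nonsquareM xN yN; rewrite xyz (quad_char_nonsquare xN).
rewrite (quad_char_nonsquare yN) quad_char_sqr //.
by apply: contraNneq (mulf_neq0 x0 y0) => z0; rewrite xyz z0 expr0n.
Qed.

Lemma quad_charX2 x : x != 0 -> quad_char x * quad_char x = 1.
Proof. by move=> x0; rewrite -quad_charM -expr2 quad_char_sqr. Qed.

Hypothesis two_neq0 : 2%:R != 0 :> F.

Lemma eq_opp0 x : x = - x -> x = 0.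
Proof.
move=> e; apply/eqP; have /eqP : x *+ 2 = 0 by rewrite mulr2n {1}e addNr.
by rewrite -mulr_natl mulf_eq0 (negbTE two_neq0).
Qed.

(** Squaring identifies 1 with -1, hence is not onto. *)
Lemma exists_nonsquare : exists n : F, ~ (exists y, n = y ^+ 2).
Proof.
suff /existsP[n nP] : [exists n : F, ~~ [exists y, n == y ^+ 2]].
  by exists n => -[y e]; move/existsP: nP; apply; exists y; apply/eqP.
apply: contraT; rewrite negb_exists => /forallP sq.
have surj n : exists y : F, n == y ^+ 2
  by apply/existsP; have := sq n; rewrite negbK.
pose s n := xchoose (surj n).
have sK : cancel s (fun y => y ^+ 2).
  by move=> n; apply/esym/eqP/(xchooseP (surj n)).
have [s' sK' s'K] := injF_bij (can_inj sK).
have inj2 : injective (fun y : F => y ^+ 2).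
  move=> a b /= e; rewrite -(s'K a) -(s'K b).
  by move: e; rewrite -{1}(s'K a) -{1}(s'K b) !sK => ->.
have /eq_opp0/eqP : 1 = -1 :> F by apply: inj2; rewrite /= sqrrN.
by rewrite oner_eq0.
Qed.

(** Scaling by a nonsquare permutes F and changes the sign of the sum. *)
Lemma sum_quad_char : \sum_(x : F) quad_char x = 0.
Proof.
have [n nN] := exists_nonsquare.
have n0 : n != 0 by apply/eqP => n0; apply: nN; exists 0; rewrite n0 expr0n.
have e : \sum_(x : F) quad_char x = - \sum_(x : F) quad_char x.
  rewrite {1}(reindex_inj (mulfI n0)) /= -sumrN; apply: eq_bigr => x _.
  by rewrite quad_charM (quad_char_nonsquare nN) mulN1r.
apply/eqP; move/eqP: e; rewrite -subr_eq0 opprK -mulr2n.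
by rewrite -mulr_natl mulf_eq0.
Qed.

Lemma sum_quad_char_affine a b :
  a != 0 -> \sum_(x : F) quad_char (b + a * x) = 0.
Proof.
move=> a0; have inj : injective (fun x => b + a * x).
  by move=> x y /addrI/(mulfI a0).
have := sum_quad_char; rewrite (reindex_inj inj); exact.
Qed.

Lemma card_sqrt c : #|[set y : F | y ^+ 2 == c]|%:Z = 1 + quad_char c.
Proof.
have [-> |c0] := eqVneq c 0.
  have -> : [set y : F | y ^+ 2 == 0] = [set 0].
    by apply/setP=> y; rewrite !inE expf_eq0.
  by rewrite cards1 quad_char0 addr0.
have [[b cb]|cN] := square_or_nonsquare c; last first.
  rewrite quad_char_nonsquare // subrr; apply/eqP; rewrite eqz_nat cards_eq0.
  apply/eqP/setP=> y; rewrite !inE; apply/negP => /eqP e.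
  by apply: cN; exists y.
have b0 : b != 0 by move: c0; rewrite cb expf_eq0.
have -> : [set y : F | y ^+ 2 == c] = [set b; - b].
  by apply/setP=> y; rewrite !inE cb eqf_sqr.
rewrite cards2 cb quad_char_sqr //.
by case: eqP => // /eq_opp0/eqP; rewrite (negbTE b0).
Qed.

(** Off t = 1 the summand equals phi (A + (A + 1) u) with u = 1 / (t - 1), an
    affine function of u unless A = -1; the value u = 0 is never taken, whence
    the term - phi A. *)
Lemma sum_quad_char_quadratic A :
  \sum_(t : F) quad_char ((t - 1) * (t * A + 1)) =
  - quad_char A + (if A == -1 then #|F|%:Z * quad_char (-1 : F) else 0).
Proof.
rewrite (bigD1 1) //= subrr mul0r quad_char0 add0r.
have -> : \sum_(t : F | t != 1) quad_char ((t - 1) * (t * A + 1)) =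
          \sum_(u : F | u != 0) quad_char (A + (A + 1) * u).
  have inj : injective (fun t : F => (t - 1)^-1) by move=> s t /invr_inj/addIr.
  rewrite [RHS](reindex_inj inj) /=; apply: eq_big => [t|t t1].
    by rewrite invr_eq0 subr_eq0.
  have d0 : t - 1 != 0 by rewrite subr_eq0.
  rewrite -[RHS]mul1r -(quad_char_sqr d0) -quad_charM; congr quad_char.
  by field.
have -> : \sum_(u : F | u != 0) quad_char (A + (A + 1) * u) =
          - quad_char A + \sum_(u : F) quad_char (A + (A + 1) * u).
  by rewrite [in RHS](bigD1 0) //= mulr0 addr0 addKr.
congr (_ + _); case: eqP => [-> |A1].
  rewrite (eq_bigr (fun=> quad_char (-1 : F))) => [|u _].
    by rewrite sumr_const -mulr_natl natz.
  by rewrite addNr mul0r addr0.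
by apply: sum_quad_char_affine; rewrite addr_eq0; apply/eqP.
Qed.

(** * The family of curves *)

Lemma frob_trace_Etf t f :
  frob_trace (Etf t f) =
  - \sum_(x : F) quad_char (x ^+ 3 + f * x ^+ 2 + t^-1 * x).
Proof.
have card_pts : #|affine_points (Etf t f)|%:Z =
    \sum_(x : F) (1 + quad_char (x ^+ 3 + f * x ^+ 2 + t^-1 * x)).
  rewrite -sum1_card -natz natr_sum.
  rewrite (partition_big (fun P : F * F => P.1) predT) //=.
  apply: eq_bigr => x _; rewrite -card_sqrt -sum1_card -natz natr_sum.
  rewrite (reindex_onto (fun y : F => (x, y)) (fun P => P.2)) /=; last first.
    by case=> x' y /andP[_ /eqP/= ->].
  apply: eq_bigl => y; rewrite !inE /= !eqxx !andbT.
  by rewrite !mul0r !addr0.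
rewrite /frob_trace /num_points PoszD card_pts big_split /=.
by rewrite sumr_const /= -mulr_natl mulr1 opprD addrA addrK opprD addrA
           natz subrr add0r.
Qed.

(** The part of the evaluation that does not depend on whether the
    discriminant f^2 - 4 is a square.  The roots of x^2 + f x + 1 are the x at
    which the quadratic in t of [sum_quad_char_quadratic] has a double root,
    and only they produce a term of size q. *)
Lemma sum_twisted_frob_trace f :
  \sum_(t : F | t != 0) quad_char (t * (t - 1)) * frob_trace (Etf t f) =
  - quad_char f -
  #|F|%:Z * \sum_(x : F | x ^+ 2 + f * x + 1 == 0) quad_char (- x).
Proof.
pose A x := x ^+ 2 + f * x.
have term t : t != 0 ->
    quad_char (t * (t - 1)) * frob_trace (Etf t f) =
    - \sum_(x : F) quad_char x * quad_char ((t - 1) * (t * A x + 1)).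
  move=> t0; rewrite frob_trace_Etf mulrN mulr_sumr; congr (- _).
  apply: eq_bigr => x _; rewrite -!quad_charM; congr quad_char.
  by rewrite /A; field.
(* The summand at t = 0, which lets t range over the whole field. *)
have zero_term :
    - \sum_(x : F) quad_char x * quad_char ((0 - 1) * (0 * A x + 1)) = 0.
  rewrite (eq_bigr (fun x => quad_char x * quad_char (-1 : F))).
    by rewrite -mulr_suml sum_quad_char mul0r oppr0.
  by move=> x _; rewrite mul0r !add0r mulr1.
rewrite (eq_bigr _ term) -[LHS]add0r -{1}zero_term.
rewrite -(bigD1 (P := predT) (0 : F)) //= sumrN exchange_big /=.
under eq_bigr => x _ do rewrite -mulr_sumr sum_quad_char_quadratic mulrDr.
rewrite big_split /= opprD; congr (_ + _); last first.
  rewrite mulr_sumr [in RHS]big_mkcond /=; congr (- _); apply: eq_bigr => x _.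
  rewrite /A -addr_eq0; case: ifP => _; last by rewrite mulr0.
  by rewrite mulrCA -quad_charM mulrN1.
rewrite -sumrN (bigD1 0) //= quad_char0 mul0r oppr0 add0r.
have -> : - quad_char f = \sum_(x : F | x != 0) quad_char (f + 1 * x).
  have := sum_quad_char_affine f (oner_neq0 F).
  by rewrite (bigD1 0) //= mulr0 addr0 => /eqP; rewrite addr_eq0 => /eqP ->;
     rewrite opprK.
apply: eq_bigr => x x0; rewrite mulrN opprK.
have -> : A x = x * (f + 1 * x) by rewrite /A; ring.
by rewrite quad_charM mulrA quad_charX2 ?mul1r.
Qed.

(** * Roots of x^2 + f x + 1 *)

(** Completing the square, as 4 is invertible. *)
Lemma quadratic_eq0 f x :
  (x ^+ 2 + f * x + 1 == 0) = ((2%:R * x + f) ^+ 2 == f ^+ 2 - 4%:R).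
Proof.
rewrite -[RHS]subr_eq0.
have -> : (2%:R * x + f) ^+ 2 - (f ^+ 2 - 4%:R) =
          2%:R ^+ 2 * (x ^+ 2 + f * x + 1) by ring.
by rewrite mulf_eq0 expf_eq0 (negbTE two_neq0).
Qed.

Lemma quadratic_eq0_sqr f s x : f ^+ 2 - 4%:R = s ^+ 2 ->
  (x ^+ 2 + f * x + 1 == 0) =
  (x == (- f + s) / 2%:R) || (x == (- f - s) / 2%:R).
Proof.
move=> fs; rewrite quadratic_eq0 fs eqf_sqr.
have half c : (2%:R * x + f == c) = (x == (- f + c) / 2%:R).
  by rewrite eq_sym -subr_eq addrC eq_sym -[RHS](inj_eq (mulfI two_neq0))
             [2%:R * (_ / _)]mulrC divfK.
by rewrite !half.
Qed.

(** The two arguments differ by the factor 1 / 4, a square. *)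
Lemma quad_char_opp_root f s : f != 0 ->
  quad_char (- ((- f + s) / 2%:R)) =
  quad_char (2%:R * f) * quad_char (1 - s / f).
Proof.
move=> f0; have i0 : 2%:R^-1 != 0 :> F by rewrite invr_eq0.
rewrite -[RHS]mul1r -(quad_char_sqr i0) -!quad_charM; congr quad_char.
by field; rewrite two_neq0 f0.
Qed.

End QuadraticCharacter.

Lemma two_neq0_finField (F : finFieldType) (p r : nat) :
  prime p -> (3 <= p)%N -> #|F| = (p ^ r)%N -> 2%:R != 0 :> F.
Proof.
move=> p_prime p_ge3 cardF; have pF := card_finPcharP cardF p_prime.
by rewrite -(dvdn_pcharf pF) gtnNdvd.
Qed.

Theorem theorem1p9 (p r q : nat) (p_prime : prime p) (p_ge3 : (3 <= p)%N)
    (r_ge1 : (1 <= r)%N) (q_def : q = (p ^ r)%N)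
    (F : finFieldType) (cardF : #|F| = q) (f : F) (f_neq0 : f != 0) :
  let S : int :=
    \sum_(t : F | t != 0) quad_char (t * (t - 1)) * frob_trace (Etf t f) in
  [/\ f ^+ 2 = 4%:R ->
        S = - quad_char f - q%:Z * quad_char (2%:R * f),
      ~ (exists b : F, f ^+ 2 - 4%:R = b ^+ 2) ->
        S = - quad_char f
    & forall a : F, a != 0 -> f ^+ 2 - 4%:R = a ^+ 2 ->
        S = - quad_char f
            - q%:Z * quad_char (2%:R * f)
              * (quad_char (1 + a / f) + quad_char (1 - a / f))].
Proof.
move=> S.
have two_neq0 : 2%:R != 0 :> F.
  by apply: two_neq0_finField p_prime p_ge3 _; rewrite cardF q_def.
have SE : S = - quad_char f -
    q%:Z * \sum_(x : F | x ^+ 2 + f * x + 1 == 0) quad_char (- x).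
  by rewrite /S sum_twisted_frob_trace // cardF.
split=> [f2|disc_nonsquare|a a0 disc]; rewrite {}SE.
- have disc0 : f ^+ 2 - 4%:R = 0 ^+ 2 by rewrite f2 subrr expr0n.
  rewrite (eq_bigl (pred1 ((- f + 0) / 2%:R))) => [|x]; last first.
    by rewrite (quadratic_eq0_sqr two_neq0 x disc0) subr0 addr0 orbb.
  by rewrite big_pred1_eq quad_char_opp_root // mul0r subr0 quad_char1 mulr1.
- rewrite big_pred0 ?mulr0 ?subr0 // => x.
  rewrite quadratic_eq0 //; apply/eqP => e.
  by apply: disc_nonsquare; exists (2%:R * x + f).
have roots_neq : (- f - a) / 2%:R != (- f + a) / 2%:R.
  rewrite (inj_eq (mulIf _)) ?invr_eq0 // (inj_eq (addrI _)).
  by apply: contra a0 => /eqP/esym/(eq_opp0 two_neq0)/eqP.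
rewrite (bigD1 ((- f + a) / 2%:R)) /=; last first.
  by rewrite (quadratic_eq0_sqr two_neq0 _ disc) eqxx.
rewrite (big_pred1 ((- f - a) / 2%:R)) => [|x]; last first.
  rewrite (quadratic_eq0_sqr two_neq0 x disc) /=.
  case: (eqVneq x ((- f + a) / 2%:R)) => [-> |_]; last by rewrite andbT.
  by rewrite andbF eq_sym (negbTE roots_neq).
rewrite !quad_char_opp_root // -mulrDr mulrA mulNr opprK.
by rewrite [quad_char (1 - _) + _]addrC.
Qed.
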